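(* Let $\Gamma$ be a tight digraph with $\deg(\Gamma)=d\ge 1$ and $\mathrm{ord}(\Gamma)=n$, where $n\neq\Delta_d x^d$ for all $x\in C_d\cap\mathbb{N}$. Then, for an integer $m\geq 1$, the dilate $m\Gamma$ is tight if and only if $1\leq m\leq \mathrm{c}(d,n)$, where $$\mathrm{c}(d,n)=\begin{cases}\beta(d,n)-1 & \text{if }\beta(d,n)\in\mathbb{N},\\ \lfloor\beta(d,n)\rfloor & \text{if }\beta(d,n)\notin\mathbb{N},\end{cases}\qquad\text{with}\qquad \beta(d,n)=\frac{1}{\left\{\sqrt[d]{\frac{n}{\Delta_d}}\right\}}.$$
   Context: In this context ''digraph'' means a Cayley digraph $\Gamma=\mathrm{Cay}(G,T)$ of a finite Abelian group $G$ with respect to a generating set $T\subset G$ with $0\notin T$: its vertex set is $G$ and its arcs are $g\to g+t$ for $g\in G$, $t\in T$. Its order is $\mathrm{ord}(\Gamma)=|\Gamma|=|G|$, its degree is $\deg(\Gamma)=|T|$, and $k(\Gamma)$ denotes its (directed) diameter. $\mathbb{N}$ is the set of nonnegative integers. For real $x$, the notation $\{x\}$ means $\{x\}=\lceil x\rceil-x$ (not the usual fractional part). The solid density of a digraph $\Gamma$ of degree $d$ and order $n$ is $\delta(\Gamma)=\dfrac{n}{(k(\Gamma)+d)^d}$, and $\Delta_d=\sup\{\delta(\Gamma):\ \deg(\Gamma)=d\}$ (a finite positive real number). Put $\ell(d,n)=\left\lceil\sqrt[d]{n/\Delta_d}\,\right\rceil-d$. The tightness of a digraph $\Gamma$ of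 degree $d$ and order $n$ is $t(d,\Gamma)=k(\Gamma)-\ell(d,n)$, and $\Gamma$ is called tight when $t(d,\Gamma)=0$. Also $C_d=\{x\in\mathbb{R}:\ \Delta_d x^d\in\mathbb{N}\}$. Dilates: let $\Gamma=\mathrm{Cay}(G,\{g_1,\dots,g_d\})$ be a digraph of degree $d$, and let $M\in\mathbb{Z}^{d\times d}$ be a matrix whose columns form a basis of the kernel lattice of $\mathbb{Z}^d\to G$, $(a_1,\dots,a_d)\mapsto\sum_i a_ig_i$. Let $\mathrm{diag}(s_1,\dots,s_d)=UMV$ be a Smith normal form decomposition ($U,V$ unimodular, $s_1\mid\cdots\mid s_d$). Then $\Gamma\cong\mathrm{Cay}(\mathbb{Z}^d/M\mathbb{Z}^d,\{e_1,\dots,e_d\})\cong\mathrm{Cay}(\mathbb{Z}_{s_1}\oplus\cdots\oplus\mathbb{Z}_{s_d},\{Ue_1,\dots,Ue_d\})$, where $e_1,\dots,e_d$ is the canonical basis of $\mathbb{Z}^d$; the set $\{Ue_1,\dots,Ue_d\}$ is called a proper generating set. For an integer $m\ge 1$, the dilate $m\Gamma$ is $m\Gamma=\mathrm{Cay}(\mathbb{Z}_{ms_1}\oplus\cdots\oplus\mathbb{Z}_{ms_d},\{Ue_1,\dots,Ue_d\})\cong\mathrm{Cay}(\mathbb{Z}^d/mM\mathbb{Z}^d,\{e_1,\dots,e_d\})$, a digraph of degree $d$ and order $m^d|\Gamma|$. *)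

(* Defs.v *)
From HB Require Import structures.
From mathcomp Require Import all_boot all_order all_algebra all_fingroup.
From mathcomp Require Import all_classical all_reals all_analysis.

Set Implicit Arguments.
Unset Strict Implicit.
Unset Printing Implicit Defensive.

Import Order.TTheory GRing.Theory Num.Theory.

Local Open Scope ring_scope.

(* The raw data (G, T) of a Cayley digraph Cay(G, T); the conditions on T are
   in [is_digraph]. *)
Record cayley := Cay { cgroup : finZmodType; cgens : {set cgroup} }.

Definition is_digraph (X : cayley) : Prop :=
  <<cgens X>>%g = [set: cgroup X] /\ 0 \notin cgens X.

Definition deg (X : cayley) : nat := #|cgens X|.

Definition ord (X : cayley) : nat := #|cgroup X|.

Definition cay_arc (X : cayley) : rel (cgroup X) :=
  [rel g h | [exists t in cgens X, h == g + t]].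

(* Least length of a directed walk from x to y.  If y is reachable from x, this
   length is less than #|V|; otherwise [find] returns the junk value #|V|. *)
Definition distance (V : finType) (e : rel V) (x y : V) : nat :=
  find (fun k => [exists p : k.-tuple V, path e x p && (last x p == y)])
       (iota 0 #|V|).

Definition diameter (X : cayley) : nat :=
  \max_(x : cgroup X) \max_(y : cgroup X) distance (@cay_arc X) x y.

Section Tightness.
Variable R : realType.

Definition solid_density (X : cayley) : R :=
  (ord X)%:R / ((diameter X + deg X) ^ deg X)%N%:R.

Definition Delta (d : nat) : R :=
  sup [set r : R | exists X : cayley,
         [/\ is_digraph X, deg X = d & r = solid_density X]]%classic.

(* The d-th root of a nonnegative x, for d > 0. *)
Definition nth_root (d : nat) (x : R) : R := x `^ (d%:R^-1).

Definition ell (d n : nat) : int :=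
  Num.ceil (nth_root d (n%:R / Delta d)) - d%:Z.

Definition tightness (X : cayley) : int :=
  (diameter X)%:Z - ell (deg X) (ord X).

Definition tight (X : cayley) : Prop := tightness X = 0.

Definition Cset (d : nat) : set R :=
  [set x : R | Delta d * x ^+ d \is a Num.nat]%classic.

(* Not the usual fractional part: the distance up to the ceiling. *)
Definition cofrac (x : R) : R := (Num.ceil x)%:~R - x.

Definition beta (d n : nat) : R := (cofrac (nth_root d (n%:R / Delta d)))^-1.

Definition cbound (d n : nat) : R :=
  if beta d n \is a Num.nat then beta d n - 1 else (Num.floor (beta d n))%:~R.

End Tightness.

Arguments Delta R d : clear implicits.
Arguments Cset R d : clear implicits.
Arguments cbound R d n : clear implicits.
Arguments tight R X : clear implicits.

(* Z_(s_0) (+) ... (+) Z_(s_(d-1)), for positive s_i; ['I_k.-1.+1] is Z_k when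
   k > 0, including the trivial group for k = 1. *)
Definition Zsum (d : nat) (s : 'I_d -> nat) : Type :=
  {dffun forall i : 'I_d, 'I_(s i).-1.+1}.

Section ZsumTheory.
Variables (d : nat) (s : 'I_d -> nat).

HB.instance Definition _ := Finite.copy (Zsum s)
  {dffun forall i : 'I_d, 'I_(s i).-1.+1}.

Definition Zsum_zero : Zsum s := [ffun i => 0 : 'I_(s i).-1.+1].
Definition Zsum_opp (x : Zsum s) : Zsum s := [ffun i => - x i].
Definition Zsum_add (x y : Zsum s) : Zsum s := [ffun i => x i + y i].

Fact Zsum_addA : associative Zsum_add.
Proof. by move=> x y z; apply/ffunP => i; rewrite !ffunE addrA. Qed.
Fact Zsum_addC : commutative Zsum_add.
Proof. by move=> x y; apply/ffunP => i; rewrite !ffunE addrC. Qed.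
Fact Zsum_add0 : left_id Zsum_zero Zsum_add.
Proof. by move=> x; apply/ffunP => i; rewrite !ffunE add0r. Qed.
Fact Zsum_addN : left_inverse Zsum_zero Zsum_opp Zsum_add.
Proof. by move=> x; apply/ffunP => i; rewrite !ffunE addNr. Qed.

HB.instance Definition _ := GRing.isZmodule.Build (Zsum s)
  Zsum_addA Zsum_addC Zsum_add0 Zsum_addN.

(* The class of an integer vector in Z_(s_0) (+) ... (+) Z_(s_(d-1)). *)
Definition Zsum_class (v : 'cV[int]_d) : Zsum s :=
  [ffun i => (inZp 1 : 'I_(s i).-1.+1) *~ v i 0].

End ZsumTheory.

(* The columns of M form a Z-basis of the lattice of integer relations between
   the g_i. *)
Definition kernel_basis (G : finZmodType) (d : nat) (g : 'I_d -> G)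
    (M : 'M[int]_d) : Prop :=
  (forall a : 'cV[int]_d,
     \sum_(i < d) g i *~ a i 0 = 0 <-> exists b : 'cV[int]_d, a = M *m b)
  /\ (forall b : 'cV[int]_d, M *m b = 0 -> b = 0).

(* diag(s) = U M V is a Smith normal form decomposition of M, with s_i >= 0. *)
Definition smith_decomposition (d : nat) (M U V : 'M[int]_d)
    (s : 'I_d -> nat) : Prop :=
  [/\ U \in unitmx, V \in unitmx,
      forall i j : 'I_d, (i <= j)%N -> (s i %| s j)%N &
      U *m M *m V = diag_mx (\row_(i < d) (s i)%:Z)].

Definition smith_dilate (d m : nat) (s : 'I_d -> nat) (U : 'M[int]_d) :
    cayley :=
  @Cay (Zsum (fun i => m * s i)%N)
       [set Zsum_class (fun i => m * s i)%N (col j U) | j : 'I_d].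

(* Y is the dilate m X computed from some enumeration of the generators of X,
   some basis of the kernel lattice and some Smith decomposition; these choices
   determine Y up to isomorphism only. *)
Definition is_dilate (m : nat) (X Y : cayley) : Prop :=
  exists (g : 'I_(deg X) -> cgroup X) (M U V : 'M[int]_(deg X))
         (s : 'I_(deg X) -> nat),
    [/\ cgens X = [set g i | i : 'I_(deg X)],
        kernel_basis g M,
        smith_decomposition M U V s &
        Y = smith_dilate m s U].

(* Main.v *)
Require Import Defs.
From mathcomp Require Import all_boot all_order all_algebra all_fingroup.
From mathcomp Require Import all_classical all_reals all_analysis.
From mathcomp Require Import ring zify.
Import Order.TTheory GRing.Theory Num.Theory.
Local Open Scope ring_scope.

(* Write a digraph of degree d as Z^d / L.  Its diameter k is the least K such
   that every class contains some a in N^d with |a| <= K.  Replacing L by m L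
   turns k + d into m (k + d): writing x = m q + r with 0 <= r_i < m and choosing
   a for q gives a representative m a + r of x, of size at most m k + d (m - 1);
   conversely, if x is a worst class modulo L, any nonnegative representative of
   m x + (m - 1, ..., m - 1) modulo m L is m b + (m - 1, ..., m - 1) with b >= 0
   congruent to x modulo L.  The order is multiplied by m^d, so, with
   y = (n / Delta_d)^(1/d), tightness of the dilate means
   m ceil(y) = ceil(m y), that is m (ceil(y) - y) < 1.  The hypothesis on n says
   that y is not an integer, and Delta_d is a genuine supremum because
   n <= (k + 1)^d bounds all solid densities by 1. *)

(** * Distances and walks in Cayley digraphs *)

Lemma distance_le {V : finType} {e : rel V} {x : V} {p : seq V} :
  path e x p -> (distance e x (last x p) <= size p)%N.
Proof.
move=> /shortenP[q eq uq sub_qp].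
(* A path without repeated vertices is short enough to lie in the range that [distance] searches, so
   the junk value [#|V|] does not arise. *)
have szq : (size q < #|V|)%N.
  by rewrite -[(size q).+1]/(size (x :: q)) -(card_uniqP uq) max_card.
have szqp : (size q <= size p)%N.
  by apply: uniq_leq_size; [case/andP: uq | exact: sub_qp].
apply: leq_trans szqp; rewrite leqNgt; apply/negP => lt_q.
have := before_find 0%N lt_q; rewrite nth_iota // add0n.
by move/existsP; apply; exists (in_tuple q); rewrite eq /= eqxx.
Qed.

Lemma distance_walk {V : finType} {e : rel V} {x : V} {p : seq V} :
  path e x p ->
  exists2 q, path e x q /\ last x q = last x p & size q = distance e x (last x p).
Proof.
move=> /shortenP[q eq uq _].
have szq : (size q < #|V|)%N.
  by rewrite -[(size q).+1]/(size (x :: q)) -(card_uniqP uq) max_card.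
set P := fun k : nat => [exists p : k.-tuple V, path e x p && (last x p == last x q)].
have hasP : has P (iota 0 #|V|).
  apply/hasP; exists (size q); first by rewrite mem_iota.
  by apply/existsP; exists (in_tuple q); rewrite eq /= eqxx.
have lt_find : (find P (iota 0 #|V|) < #|V|)%N.
  by move: hasP; rewrite has_find size_iota.
have := nth_find 0%N hasP; rewrite nth_iota // add0n => /existsP[t /andP[et /eqP lt]].
by exists t; rewrite ?size_tuple.
Qed.

Lemma cay_walkP {X : cayley} {x y : cgroup X} {k : nat} :
  (exists p, [/\ path (@cay_arc X) x p, last x p = y & size p = k]) <->
  (exists s, [/\ all (mem (cgens X)) s, y = x + \sum_(t <- s) t & size s = k]).
Proof.
split.
  case=> p []; elim: p x k => [|z p IH] x k /=.
    by move=> _ <- <-; exists [::]; rewrite big_nil addr0.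
  case/andP=> /existsP[t /andP[tT /eqP ->]] hp hy <-.
  have [s [hs ey <-]] := IH _ _ hp hy erefl.
  by exists (t :: s); rewrite /= tT hs big_cons addrA.
case=> s []; elim: s x k => [|t s IH] x k /=.
  by rewrite big_nil addr0 => _ -> <-; exists [::].
case/andP=> tT hs; rewrite big_cons addrA => ey <-.
have [p [hp hy <-]] := IH _ _ hs ey erefl.
exists (x + t :: p); split=> //=; rewrite hp andbT.
by apply/existsP; exists t; rewrite tT eqxx.
Qed.

(** * Diameter as a covering bound *)

(** Cayley digraphs are translation invariant, so bounding the distances from 0 bounds the diameter.
    Order is irrelevant in an Abelian group, so a walk reduces to the multiplicities of its
    generators. *)
Definition covers {G : zmodType} {d : nat} (g : 'I_d -> G) (K : nat) : Prop :=
  forall z, exists2 a : 'I_d -> nat, (\sum_i a i <= K)%N & z = \sum_i g i *+ a i.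

(** In a finite group inverses are positive powers, so directed walks already reach the whole
    generated subgroup. *)
Lemma gen_sum_seq {G : finZmodType} {T : {set G}} : <<T>>%g = [set: G] ->
  forall z, exists2 s, all (mem T) s & z = \sum_(t <- s) t.
Proof.
move=> genT z; have /gen_prodgP[n [c cT ->]] : z \in <<T>>%g by rewrite genT inE.
exists [seq c i | i <- enum 'I_n]; first by apply/allP => _ /mapP[i _ ->]; apply: cT.
by rewrite big_map big_enum.
Qed.

Lemma seq_of_coeffs {G : zmodType} {d : nat} (g : 'I_d -> G) (a : 'I_d -> nat) :
  exists s, [/\ {subset s <= codom g}, \sum_(t <- s) t = \sum_i g i *+ a i
              & size s = (\sum_i a i)%N].
Proof.
exists (flatten [seq nseq (a i) (g i) | i <- enum 'I_d]); split.
- move=> t /flattenP[_ /mapP[i _ ->]] /nseqP[-> _]; exact: codom_f.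
- rewrite big_flatten big_map big_enum; apply: eq_bigr => i _.
  by rewrite big_nseq -Monoid.iteropE; case: (a i) => //= k; rewrite GRing.mulrSr.
- rewrite size_flatten /shape -map_comp sumnE big_map big_enum.
  by apply: eq_bigr => i _ /=; rewrite size_nseq.
Qed.

Lemma coeffs_of_seq {G : zmodType} {d : nat} (g : 'I_d -> G) (s : seq G) :
  {subset s <= codom g} ->
  exists2 a : 'I_d -> nat, (\sum_i a i)%N = size s & \sum_(t <- s) t = \sum_i g i *+ a i.
Proof.
elim: s => [_|t s IH sub_ts].
  exists (fun=> 0%N); first by rewrite big1.
  by rewrite big_nil big1 // => i _; rewrite mulr0n.
have [|a sa ea] := IH; first by move=> u us; apply: sub_ts; rewrite inE us orbT.
have /codomP[j ->] := sub_ts t (mem_head _ _).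
exists (fun i => (i == j) + a i)%N.
  by rewrite big_split /= sa (bigD1 j) //= eqxx big1 // => i /negbTE->.
rewrite big_cons ea; under [RHS]eq_bigr => i _ do rewrite mulrnDr.
rewrite big_split /=; congr (_ + _).
by rewrite (bigD1 j) //= eqxx mulr1n big1 ?addr0 // => i /negbTE->.
Qed.

Lemma diameter_le_covers {X : cayley} {d : nat} {g : 'I_d -> cgroup X} {K : nat} :
  cgens X = [set g i | i : 'I_d] -> covers g K -> (diameter X <= K)%N.
Proof.
move=> gX cK; apply/bigmax_leqP => x _; apply/bigmax_leqP => y _.
have [a aK za] := cK (y - x).
have [s [sub_s es sz]] := seq_of_coeffs g a.
have [|p [hp hy sp]] := (@cay_walkP X x y (size s)).2.
  exists s; split=> //; last by rewrite es -za addrC subrK.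
  by apply/allP => t /sub_s /codomP[i ->]; rewrite /= gX imset_f.
by rewrite -hy; apply: leq_trans (distance_le hp) _; rewrite sp sz.
Qed.

(** Generation is assumed in the form of sums so that the lemma also applies to the dilate, whose
    generation is obtained from a covering. *)
Lemma covers_diameter {X : cayley} {d : nat} {g : 'I_d -> cgroup X} :
  cgens X = [set g i | i : 'I_d] ->
  (forall z, exists2 s, all (mem (cgens X)) s & z = \sum_(t <- s) t) ->
  covers g (diameter X).
Proof.
move=> gX gen z; have [s hs zs] := gen z.
have [|p [hp hy _]] := (@cay_walkP X 0 z (size s)).2; first by exists s; rewrite add0r.
have [q [hq hyq] szq] := distance_walk hp; rewrite hy in hyq szq.
have [|u [hu ez szu]] := (@cay_walkP X 0 z (size q)).1; first by exists q.
have [|a sa ea] := @coeffs_of_seq _ _ g u.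
  by move=> t /(allP hu); rewrite /= gX => /imsetP[i _ ->]; apply: codom_f.
exists a; last by rewrite ez add0r.
rewrite sa szu szq /diameter.
exact: leq_trans (leq_bigmax z) (leq_bigmax (0 : cgroup X)).
Qed.

(** * Integer combinations, and coverings under dilation of the lattice *)

(** The homomorphism from Z^d whose kernel is the lattice L of relations. *)
Definition int_sum {G : zmodType} {d : nat} (g : 'I_d -> G) (v : 'cV[int]_d) : G :=
  \sum_i g i *~ v i 0.

Lemma int_sumD {G : zmodType} {d : nat} (g : 'I_d -> G) (u v : 'cV[int]_d) :
  int_sum g (u + v) = int_sum g u + int_sum g v.
Proof. by rewrite -big_split; apply: eq_bigr => i _; rewrite mxE mulrzDr. Qed.

Lemma int_sumB {G : zmodType} {d : nat} (g : 'I_d -> G) (u v : 'cV[int]_d) :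
  int_sum g (u - v) = int_sum g u - int_sum g v.
Proof. by apply/eqP; rewrite eq_sym subr_eq -int_sumD subrK. Qed.

Lemma int_sumMn {G : zmodType} {d : nat} (g : 'I_d -> G) (v : 'cV[int]_d) (n : nat) :
  int_sum g (v *+ n) = int_sum g v *+ n.
Proof.
elim: n => [|n IH]; last by rewrite !mulrS int_sumD IH.
by rewrite !mulr0n; apply: big1 => i _; rewrite mxE mulr0z.
Qed.

Lemma int_sum_nat {G : zmodType} {d : nat} (g : 'I_d -> G) (a : 'I_d -> nat) :
  int_sum g (\col_i (a i)%:Z) = \sum_i g i *+ a i.
Proof. by apply: eq_bigr => i _; rewrite mxE. Qed.

Lemma int_sum_delta {G : zmodType} {d : nat} (g : 'I_d -> G) (i : 'I_d) :
  int_sum g (delta_mx i 0) = g i.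
Proof.
rewrite /int_sum (bigD1 i) //= mxE !eqxx big1 ?addr0 // => j /negbTE ij.
by rewrite mxE ij.
Qed.

Lemma covers_int_sum {G : zmodType} {d : nat} {g : 'I_d -> G} {K : nat} :
  covers g K -> forall z, exists x, z = int_sum g x.
Proof.
by move=> cK z; have [a _ ->] := cK z; exists (\col_i (a i)%:Z); rewrite int_sum_nat.
Qed.

(** The term [m.-1 * d] pays for d remainders modulo m, each at most m - 1. The kernel hypothesis
    says that m L lies in the kernel of [g']. *)
Lemma covers_dilate {G G' : zmodType} {d m K : nat} {g : 'I_d -> G} {g' : 'I_d -> G'} :
  (0 < m)%N ->
  (forall v, int_sum g v = 0 -> int_sum g' (v *+ m) = 0) ->
  (forall z, exists x, z = int_sum g' x) ->
  covers g K -> covers g' (m * K + m.-1 * d)%N.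
Proof.
move=> m0 kerm surj cK z; have [x ->] := surj z.
have m_neq0 : m%:Z != 0 by rewrite eqz_nat -lt0n.
set q : 'cV[int]_d := \col_i (x i 0%R %/ m%:Z)%Z.
have [a aK qa] := cK (int_sum g q).
exists (fun i => m * a i + `|x i 0%R %% m%:Z|%Z)%N.
  rewrite big_split /= -big_distrr /= leq_add ?leq_mul2l ?aK ?orbT //.
  rewrite mulnC -[X in (_ <= X * _)%N](card_ord d) -sum_nat_const.
  apply: leq_sum => i _; rewrite -ltnS prednK // -ltz_nat gez0_abs ?modz_ge0 //.
  by rewrite ltz_mod.
rewrite -int_sum_nat; apply/eqP; rewrite -subr_eq0 -int_sumB; apply/eqP.
(* The vector x minus its representative is m (q - a), and q - a is a relation between the [g i]. *)
rewrite -[RHS](kerm (q - \col_i (a i)%:Z)); last first.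
  by rewrite int_sumB qa int_sum_nat subrr.
congr int_sum; apply/colP => i.
rewrite mulmxnE !mxE PoszD PoszM gez0_abs ?modz_ge0 //.
by rewrite {1}(divz_eq (x i 0) m%:Z) -mulr_natl natz; ring.
Qed.

(** The bound is kept in additive form because [m.-1 * d <= K] is not known beforehand; it follows
    from the conclusion. *)
Lemma covers_undilate {G G' : zmodType} {d m K : nat} {g : 'I_d -> G} {g' : 'I_d -> G'} :
  (0 < m)%N ->
  (forall v, int_sum g' v = 0 -> exists2 c, v = c *+ m & int_sum g c = 0) ->
  (forall z, exists x, z = int_sum g x) ->
  covers g' K ->
  forall z, exists2 b : 'I_d -> nat,
    (m * \sum_i b i + m.-1 * d <= K)%N & z = \sum_i g i *+ b i.
Proof.
move=> m0 kerm surj cK z; have [x ->] := surj z.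
have [a aK xa] := cK (int_sum g' (x *+ m + const_mx m.-1%:Z)).
have [|c ec kc] := kerm (x *+ m + const_mx m.-1%:Z - \col_i (a i)%:Z).
  by rewrite int_sumB xa int_sum_nat subrr.
have ea i : (a i)%:Z = (x - c) i 0 *+ m + m.-1%:Z.
  have /colP/(_ i) := ec; rewrite !mulmxnE !mxE mulmxnE mulrnBl => <-; ring.
(* With y = x - c, a_i = m y_i + (m - 1), and y_i <= -1 would make a_i negative. The shift m - 1 is
   the largest one with this effect. *)
have y_ge0 i : 0 <= (x - c) i 0.
  rewrite leNgt; apply/negP => y_lt0; have := ea i; move: y_lt0.
  rewrite -lezD1 => y_le; have := lerMn2r m ((x - c) i 0 + 1) 0.
  rewrite y_le orbT mul0rn mulrnDl -[X in 1 *+ X](prednK m0) mulrS natz.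
  by move=> le0; rewrite [1 + _]addrC addrA -ea lezD1 ltNge in le0.
exists (fun i => absz ((x - c)%R i 0%R)).
  apply: leq_trans aK; rewrite mulnC -[d in (_ + _ * d)%N](card_ord d) mulnC.
  rewrite [(m.-1 * _)%N]mulnC -sum_nat_const big_distrr -big_split /= leq_eqVlt.
  apply/orP; left; apply/eqP; apply: eq_bigr => i _; apply/eqP; rewrite -eqz_nat.
  by rewrite ea PoszD PoszM gez0_abs // -mulr_natl natz.
rewrite -int_sum_nat -[LHS]subr0 -kc -int_sumB; congr int_sum; apply/colP => i.
by rewrite [RHS]mxE gez0_abs.
Qed.

(** * The relation lattice of the Smith dilate *)

(** Positivity matters: for [s i = 0] the component is the trivial group, whereas 0 divides only
    0. *)
Lemma Zsum_class_eq0 {d : nat} {s : 'I_d -> nat} (v : 'cV[int]_d) :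
  (forall i, (0 < s i)%N) ->
  Zsum_class s v = 0 <-> forall i, ((s i)%:Z %| v i 0%R)%Z.
Proof.
move=> s0.
have Zp0P i (z : int) : ((inZp 1 : 'I_(s i).-1.+1) *~ z == 0) = ((s i)%:Z %| z)%Z.
  have nat_case k : ((inZp 1 : 'I_(s i).-1.+1) *+ k == 0) = ((s i) %| k)%N.
    by rewrite Zp_mulrn -val_eqE /= prednK // modnMml mul1n.
  by case: z => k; rewrite dvdzE /= -nat_case // NegzE mulrNz oppr_eq0.
split=> [/ffunP v0 i | v0].
  by have := v0 i; rewrite !ffunE => /eqP; rewrite Zp0P.
by apply/ffunP => i; rewrite !ffunE; apply/eqP; rewrite Zp0P.
Qed.

Lemma Zsum_class_surj {d : nat} (s : 'I_d -> nat) (z : Zsum s) :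
  exists v, z = Zsum_class s v.
Proof.
exists (\col_i (nat_of_ord (z i))%:Z); apply/ffunP => i; rewrite ffunE mxE.
rewrite -pmulrn Zp_mulrn; apply/val_inj.
by rewrite /= modnMml mul1n modn_small.
Qed.

Lemma int_sum_class {d : nat} (s : 'I_d -> nat) (U : 'M[int]_d) (v : 'cV[int]_d) :
  int_sum (fun j => Zsum_class s (col j U)) v = Zsum_class s (U *m v).
Proof.
apply/ffunP => i; rewrite ffunE mxE /int_sum.
rewrite (big_morph (fun z : Zsum s => z i) (_ : {morph _ : x y / x + y}) (_ : _ = 0)).
- rewrite mulrz_sumr; apply: eq_bigr => j _.
  have evalM (z : Zsum s) (k : int) : (z *~ k) i = (z i) *~ k.
    have evaln (n : nat) : (z *+ n) i = (z i) *+ n.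
      by elim: n => [|n IH]; rewrite ?mulr0n ?ffunE // !mulrS ffunE IH.
    by case: k => n; rewrite ?evaln // NegzE !mulrNz ffunE evaln.
  by rewrite evalM ffunE mxE mulrzA.
- by move=> x y; rewrite ffunE.
- by rewrite ffunE.
Qed.

(** If s_i = 0, then M kills the nonzero vector V e_i, against the independence of its columns. *)
Lemma smith_pos {G : finZmodType} {d : nat} {g : 'I_d -> G} {M U V : 'M[int]_d}
    {s : 'I_d -> nat} :
  kernel_basis g M -> smith_decomposition M U V s -> forall i, (0 < s i)%N.
Proof.
move=> [_ injM] [uU uV _ UMV] i; rewrite lt0n; apply/negP => /eqP si0.
have UMVi0 : U *m M *m V *m delta_mx i (0 : 'I_1) = 0.
  rewrite UMV mul_diag_mx; apply/colP => j; rewrite !mxE.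
  by have [->|_] := eqVneq j i; rewrite ?si0 ?mul0r ?mulr0.
have MVi0 : M *m (V *m delta_mx i (0 : 'I_1)) = 0.
  by apply: (can_inj (mulKmx uU)); rewrite mulmx0 !mulmxA.
have /colP/(_ i) : delta_mx i (0 : 'I_1) = 0 :> 'cV[int]_d.
  by rewrite -[LHS](mulKmx uV) (injM _ MVi0) mulmx0.
by rewrite !mxE !eqxx.
Qed.

(** The kernel is m L: since U (m M V c) has entries m s_i c_i, the quotients of the entries of U v
    by m s_i are the coordinates of v in the basis m M V of m L. *)
Lemma smith_dilate_kernel {G : finZmodType} {d m : nat} {g : 'I_d -> G}
    {M U V : 'M[int]_d} {s : 'I_d -> nat} (v : 'cV[int]_d) :
  (0 < m)%N -> kernel_basis g M -> smith_decomposition M U V s ->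
  int_sum (fun j => Zsum_class (fun i => m * s i)%N (col j U)) v = 0 <->
  exists2 c, v = c *+ m & int_sum g c = 0.
Proof.
move=> m0 kM sM; have s0 := smith_pos kM sM; have [kerM injM] := kM.
have [uU uV _ UMV] := sM; have ms0 i : (0 < m * s i)%N by rewrite muln_gt0 m0 s0.
have UMVE (c : 'cV_d) : U *m ((M *m (V *m c)) *+ m) = \col_i (c i 0 * (m * s i)%:Z).
  rewrite -scaler_nat -scalemxAr !mulmxA UMV mul_diag_mx.
  by apply/colP => i; rewrite !mxE PoszM natz; ring.
rewrite int_sum_class; apply: iff_trans (Zsum_class_eq0 _ ms0) _; split.
- move=> dvd; have [q qE] := choice (fun i => elimT dvdzP (dvd i)).
  exists (M *m (V *m \col_i q i)); last by apply/kerM; exists (V *m \col_i q i).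
  apply: (can_inj (mulKmx uU)); rewrite UMVE; apply/colP => i.
  by rewrite [RHS]mxE [X in _ = X * _]mxE qE.
- case=> c -> /kerM[b ->] i; rewrite -[b](mulKVmx uV) UMVE mxE.
  by apply/dvdzP; eexists.
Qed.

(** Lifting G to Z^d and mapping down to G' is injective when the kernel of [g'] lies in that of
    [g]. *)
Lemma card_le_of_kernel {G G' : finZmodType} {d : nat} {g : 'I_d -> G} {g' : 'I_d -> G'} :
  (forall z, exists x, z = int_sum g x) ->
  (forall v, int_sum g' v = 0 -> int_sum g v = 0) ->
  (#|G| <= #|G'|)%N.
Proof.
move=> /choice[f fK] sub; apply: (@leq_card _ _ (int_sum g' \o f)) => x y /= exy.
apply/eqP; rewrite -subr_eq0 [x in x - _]fK [y in _ - y]fK -int_sumB sub //.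
by rewrite int_sumB exy subrr.
Qed.

Lemma card_Zsum {d : nat} (s : 'I_d -> nat) :
  (forall i, (0 < s i)%N) -> #|{: Zsum s}| = (\prod_i s i)%N.
Proof.
move=> s0; rewrite card_dep_ffun foldrE big_map big_enum.
by apply: eq_bigr => i _; rewrite card_ord prednK.
Qed.

Lemma int_sum_class_surj {d : nat} (s : 'I_d -> nat) (U : 'M[int]_d) :
  U \in unitmx ->
  forall z, exists x, z = int_sum (fun j => Zsum_class s (col j U)) x.
Proof.
move=> uU z; have [v ->] := Zsum_class_surj s z; exists (invmx U *m v).
by rewrite int_sum_class mulKVmx.
Qed.

Lemma covers_digraph {X : cayley} {d : nat} {g : 'I_d -> cgroup X} :
  is_digraph X -> cgens X = [set g i | i : 'I_d] -> covers g (diameter X).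
Proof. by case=> genX _ gX; apply: covers_diameter => //; apply: gen_sum_seq. Qed.

(** * Order, degree and diameter of the dilate *)

Section Dilate.
Context {X : cayley} {d m : nat} {g : 'I_d -> cgroup X} {M U V : 'M[int]_d}.
Context {s : 'I_d -> nat}.
Hypotheses (hX : is_digraph X) (gX : cgens X = [set g i | i : 'I_d]).
Hypotheses (kM : kernel_basis g M) (sM : smith_decomposition M U V s) (m0 : (0 < m)%N).

Let Y := smith_dilate m s U.
Let g' (j : 'I_d) : cgroup Y := Zsum_class (fun i => m * s i)%N (col j U).

Lemma ord_dilate : ord Y = (m ^ d * ord X)%N.
Proof.
have s0 := smith_pos kM sM; have [uU _ _ _] := sM.
have oX : ord X = (\prod_i s i)%N.
  (* The dilate by 1 has the same relation lattice as X, so comparing kernels in both directions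
     gives |X| as the product of the s_i. *)
  rewrite /ord; transitivity #|{: Zsum (fun i => 1 * s i)%N}|.
    apply/eqP; rewrite eqn_leq; apply/andP; split.
      apply: (@card_le_of_kernel _ _ d g) (covers_int_sum (covers_digraph hX gX)) _ => v.
      by move=> /(smith_dilate_kernel v (ltn0Sn 0) kM sM)[c -> kc]; rewrite mulr1n.
    apply: (@card_le_of_kernel (Zsum (fun i => 1 * s i)%N) _ d _ g) => [|v kv].
      exact: (int_sum_class_surj _ _ uU).
    by apply/(smith_dilate_kernel v (ltn0Sn 0) kM sM); exists v.
  rewrite card_Zsum; first by apply: eq_bigr => i _; rewrite mul1n.
  by move=> i; rewrite mul1n.
rewrite oX /ord card_Zsum; last by move=> i; rewrite muln_gt0 m0 s0.
by rewrite big_split /= prod_nat_const card_ord.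
Qed.

(** The generators of Y stay distinct: if those of index i and j agree, then e_i - e_j lies in m L,
    hence in L, and [g i = g j]; but [g] is injective, its image having d elements. *)
Lemma deg_dilate : deg X = d -> deg Y = d.
Proof.
move=> dX; have injg : injective g.
  have /imset_injP : #|[set g i | i in 'I_d]| == #|'I_d|.
    by rewrite -gX card_ord; apply/eqP.
  by move=> inj i j; apply: inj.
rewrite /deg card_imset ?card_ord // => i j.
rewrite -/(g' i) -/(g' j) -(int_sum_delta g') -(int_sum_delta g' j).
move=> /eqP; rewrite -subr_eq0 -int_sumB => /eqP.
move=> /(smith_dilate_kernel _ m0 kM sM)[c eij kc].
apply: injg; apply/eqP; rewrite -subr_eq0 -(int_sum_delta g i) -(int_sum_delta g j).
by rewrite -int_sumB eij int_sumMn kc mul0rn.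
Qed.

Lemma diameter_dilate : diameter Y = (m * diameter X + m.-1 * d)%N.
Proof.
have [uU _ _ _] := sM; have covX := covers_digraph hX gX.
have covY : covers g' (m * diameter X + m.-1 * d)%N.
  apply: covers_dilate covX => //; last exact: int_sum_class_surj.
  by move=> v kv; apply/(smith_dilate_kernel _ m0 kM sM); exists v.
have gY : cgens Y = [set g' i | i : 'I_d] by [].
apply/eqP; rewrite eqn_leq (diameter_le_covers gY covY) /=.
have genY : forall z, exists2 t, all (mem (cgens Y)) t & z = \sum_(x <- t) x.
  move=> z; have [a _ ->] := covY z; have [t [sub_t <- _]] := seq_of_coeffs g' a.
  by exists t => //; apply/allP => x /sub_t /codomP[j ->]; apply: imset_f.
have dX := covers_undilate m0 (fun v => (smith_dilate_kernel v m0 kM sM).1)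
  (covers_int_sum covX) (covers_diameter gY genY).
(* This makes the truncated subtraction below a true one. *)
have le_dY : (m.-1 * d <= diameter Y)%N.
  by have [b le_b _] := dX 0; apply: leq_trans le_b; apply: leq_addl.
rewrite addnC -leq_subRL // mulnC -leq_divRL //; apply: (diameter_le_covers gX) => z.
have [b le_b zb] := dX z; exists b => //.
by rewrite leq_divRL // mulnC leq_subRL // addnC.
Qed.

End Dilate.

(** * Solid densities and positivity of their supremum *)

(** Every coefficient is at most K, so the vectors with entries in 0..K already map onto G. *)
Lemma covers_card {G : finZmodType} {d K : nat} {g : 'I_d -> G} :
  covers g K -> (#|G| <= K.+1 ^ d)%N.
Proof.
move=> cK; rewrite -[K.+1]card_ord -[X in (_ ^ X)%N](card_ord d) -card_ffun.
pose f (a : {ffun 'I_d -> 'I_K.+1}) := \sum_i g i *+ a i.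
rewrite -(card_codom (_ : injective (@id G))) //.
apply: leq_trans (leq_image_card f predT); apply: subset_leq_card.
apply/fintype.subsetP => z _; have [a aK ->] := cK z; apply/codomP.
exists [ffun i => inord (a i)]; apply: eq_bigr => i _; rewrite ffunE inordK //.
by rewrite ltnS (leq_trans _ aK) // (bigD1 i) //= leq_addr.
Qed.

Lemma digraph_enum {X : cayley} {d : nat} : deg X = d ->
  exists g : 'I_d -> cgroup X, cgens X = [set g i | i : 'I_d].
Proof.
move=> <-; exists enum_val; apply/setP => x; apply/idP/imsetP => [xT | [i _ ->]].
  by exists (enum_rank_in xT x); rewrite // enum_rankK_in.
exact: enum_valP.
Qed.

Lemma cay_ord_gt0 (X : cayley) : (0 < ord X)%N.
Proof. by apply/card_gt0P; exists 0. Qed.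

Lemma solid_density_le1 {R : realType} {X : cayley} : is_digraph X -> (0 < deg X)%N ->
  solid_density R X <= 1.
Proof.
move=> hX d0; have [g gX] := digraph_enum (erefl (deg X)).
have d_pos : (0 < (diameter X + deg X) ^ deg X)%N by rewrite expn_gt0 addn_gt0 d0 orbT.
rewrite /solid_density /ord ler_pdivrMr ?ltr0n // mul1r ler_nat.
apply: leq_trans (covers_card (covers_digraph hX gX)) _.
by rewrite leq_exp2r // -addn1 leq_add2l.
Qed.

Lemma Delta_gt0 {R : realType} {X : cayley} : is_digraph X -> (0 < deg X)%N ->
  0 < Delta R (deg X).
Proof.
move=> hX d0; have dens0 : 0 < solid_density R X.
  by rewrite divr_gt0 ?ltr0n ?cay_ord_gt0 // expn_gt0 addn_gt0 d0 orbT.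
apply: lt_le_trans dens0 _; apply: ub_le_sup; last by exists X.
exists 1 => _ [Z [hZ dZ ->]]; apply: solid_density_le1 => //.
by rewrite dZ.
Qed.

(** * Roots, ceilings and the bound c(d, n) *)

Lemma nth_rootK {R : realType} {d : nat} {x : R} : (0 < d)%N -> 0 <= x ->
  nth_root d x ^+ d = x.
Proof.
move=> d0 x0; rewrite /nth_root -powR_mulrn ?powR_ge0 // -powRrM mulVf ?powRr1 //.
by rewrite pnatr_eq0 -lt0n.
Qed.

Lemma nth_rootX {R : realType} {d : nat} (m : nat) {x : R} : (0 < d)%N -> 0 <= x ->
  nth_root d (m%:R ^+ d * x) = m%:R * nth_root d x.
Proof.
move=> d0 x0; rewrite /nth_root powRM ?exprn_ge0 ?ler0n //; congr (_ * _).
by rewrite -powR_mulrn ?ler0n // -powRrM divff ?powRr1 ?ler0n // pnatr_eq0 -lt0n.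
Qed.

(** The integer m ceil(y) is always at least m y, so it is the ceiling of m y exactly when it
    exceeds m y by less than 1. *)
Lemma ceilM_nat {R : realType} {m : nat} {y : R} :
  (Num.ceil (m%:R * y) == Num.ceil y *+ m) = (m%:R * cofrac y < 1).
Proof.
have ceilM : (Num.ceil y *+ m)%:~R = m%:R * (Num.ceil y)%:~R :> R.
  by rewrite rmorphMn /= mulr_natl.
rewrite ceil_eq intrD ceilM mulrN1z ler_wpM2l ?ler0n ?ceil_ge // andbT /cofrac.
by rewrite mulrBr ltrBlDr ltrBlDr addrC.
Qed.

Lemma cofrac_gt0 {R : realType} {y : R} : y \isn't a Num.int -> 0 < cofrac y.
Proof.
rewrite intrEceil /cofrac subr_gt0 => ny.
by rewrite lt_neqAle eq_sym ny ceil_ge.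
Qed.

(** Both branches of [cbound] express strict inequality for natural m: when [beta] is not natural, m
    = [beta] is impossible. *)
Lemma le_cbound {R : realType} {d n m : nat} :
  (m%:R <= cbound R d n) = (m%:R < beta R d n).
Proof.
rewrite /cbound; case: ifPn => [/natrP[k ->] | nb].
  by rewrite lerBrDr natr1 ler_nat ltr_nat.
rewrite -[m%:R](mulrz_nat) ler_int floor_ge_int le_eqVlt; case: eqP nb => //= <-.
by rewrite mulrz_nat natr_nat.
Qed.

Theorem theorem5 (R : realType) (d n : nat) (X : cayley) (hX : is_digraph X)
    (hd : deg X = d) (hd1 : (1 <= d)%N) (hn : ord X = n) (htight : tight R X)
    (hneq : forall x : nat, x%:R \in Cset R d -> n%:R <> Delta R d * x%:R ^+ d)
    (m : nat) (hm : (1 <= m)%N) (Y : cayley) (hY : is_dilate m X Y) :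
  tight R Y <-> (1 <= m)%N /\ m%:R <= cbound R d n.
Proof.
have [g [M [U [V [s [gX kM sM eY]]]]]] := hY.
have dY : deg Y = deg X by rewrite eY; apply: (deg_dilate gX kM sM hm).
have oY : ord Y = (m ^ deg X * ord X)%N by rewrite eY; apply: (ord_dilate hX gX kM sM hm).
have kY : diameter Y = (m * diameter X + m.-1 * deg X)%N.
  by rewrite eY; apply: (diameter_dilate hX gX kM sM hm).
have D0 : 0 < Delta R d by rewrite -hd; apply: Delta_gt0; rewrite ?hd.
set y := nth_root d (n%:R / Delta R d).
have nD0 : 0 <= n%:R / Delta R d by rewrite divr_ge0 ?ler0n // ltW.
(* An integral y is a natural x, being nonnegative; then n = Delta_d x^d, so x lies in C_d, contrary
   to [hneq]. *)
have y_nint : y \isn't a Num.int.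
  apply/negP => y_int; have : y \is a Num.nat by rewrite natrEint y_int powR_ge0.
  case/natrP => x yx; have ndx : n%:R = Delta R d * x%:R ^+ d.
    by rewrite -yx nth_rootK // mulrC divfK ?gt_eqF.
  by apply: (hneq x) (ndx); rewrite inE /Cset /= -ndx natr_nat.
have kX : (diameter X)%:Z + d%:Z = Num.ceil y.
  by move: htight; rewrite /tight /tightness /ell hd hn -/y => h; lia.
have rootY : nth_root d ((ord Y)%:R / Delta R d) = m%:R * y.
  by rewrite oY hd hn natrM natrX -mulrA nth_rootX.
have kYd : (diameter Y)%:Z + d%:Z = Num.ceil y *+ m.
  by rewrite kY hd -kX -mulr_natl natz -!PoszD -addnA -mulSnr prednK // -mulnDr PoszM.
have -> : tight R Y <-> Num.ceil (m%:R * y) == Num.ceil y *+ m.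
  rewrite /tight /tightness /ell dY hd rootY -kYd.
  by split=> [h|/eqP h]; [apply/eqP|]; lia.
(* As y is not an integer, [cofrac y] is positive and can be divided by, turning m [cofrac y] < 1
   into m < [beta]. *)
rewrite ceilM_nat le_cbound /beta -/y -ltr_pdivlMr ?cofrac_gt0 // mul1r.
by split=> [?|[]].
Qed.
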